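(* Let $m\ge 2$ and $i,j\in[m]$ with $i\neq j$. If $Z\in\mathcal{C}_{\{i,j\}}$ and $Z_{n+2,n+2}=1$, then $\mathcal{Z}_{i,j}(\pi_X(Z),\pi_x(Z))\succeq 0$.
   Context: Let $[m]=\{1,\dots,m\}$, let $n\ge 1$, and let $c^i\in\mathbb{R}^n$, $r_i\in\mathbb{R}$ for $i\in[m]$ be such that $S:=\{x\in\mathbb{R}^n: \|x-c^i\|_2\le r_i,\ \forall i\in[m]\}$ is nonempty. $\mathbb{S}^k$ is the space of real symmetric $k\times k$ matrices, $\mathbb{S}^k_+$ the cone of positive semidefinite ones, $A\succeq 0$ means $A$ is positive semidefinite, and $\langle A,B\rangle=\operatorname{tr}(AB)$ for symmetric matrices. The second-order cone is $\mathbb{L}^{n+2}:=\{x\in\mathbb{R}^{n+2}: \|(x_1,\ldots,x_{n+1})\|_2\le x_{n+2}\}$. With $I$ the $n\times n$ identity, define $$Q:=\begin{bmatrix}-2I & 0 & 0\\0 & 0 & 1\\0 & 1 & 0\end{bmatrix},\quad P:=\begin{bmatrix}2I & 0 & 0\\ 0 & 1 & -1\\0 & 1 & 1\end{bmatrix},\quad d^i:=\begin{bmatrix}2c^i\\ -1\\ r_i^2-\|c^i\|_2^2\end{bmatrix}\in\mathbb{R}^{n+2},\ i\in[m],$$ and for $i\neq j$ $$\mathcal{C}_{\{i,j\}}:=\{Z\in\mathbb{S}^{n+2}_+:\ \langle Q,Z\rangle=0,\ PZd^i\in\mathbb{L}^{n+2},\ PZd^j\in\mathbb{L}^{n+2},\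 (d^i)^\top Zd^j\ge 0\}.$$ For $Z\in\mathbb{S}^{n+2}$, $\pi_X(Z)\in\mathbb{S}^n$ is the leading principal $n\times n$ submatrix of $Z$ and $\pi_x(Z):=(Z_{1,n+2},\ldots,Z_{n,n+2})^\top\in\mathbb{R}^n$. For $(X,x)\in\mathbb{S}^n\oplus\mathbb{R}^n$ define the $2n\times 2n$ symmetric matrix $$\mathcal{Z}_{i,j}(X,x):=\begin{bmatrix} r_i^2 I & X-x(c^j)^\top-c^ix^\top+c^i(c^j)^\top\\ X-c^jx^\top-x(c^i)^\top+c^j(c^i)^\top & r_j^2 I\end{bmatrix}.$$ *)

(* Defs.v *)
From mathcomp Require Import all_boot all_order all_algebra.
From mathcomp Require Import classical_sets reals.

Set Implicit Arguments.
Unset Strict Implicit.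
Unset Printing Implicit Defensive.

Import Order.TTheory GRing.Theory Num.Theory.
Local Open Scope ring_scope.
Local Open Scope classical_set_scope.

(* R^(n+2) is ['cV[R]_(n + 1 + 1)], so that block matrices follow the partition
   (n, 1, 1) and the (n+2)-nd coordinate is the lower block. *)

Section Defs.
Variable R : realType.

(* The norm that the library puts on matrices is the sup norm. *)
Definition norm2 k (x : 'cV[R]_k) : R := Num.sqrt (\sum_(i < k) x i 0 ^+ 2).

Definition psd k : set 'M[R]_k :=
  [set A | A \is symmetricmx /\ forall v : 'cV[R]_k, 0 <= (v^T *m A *m v) 0 0].

Definition inner_mx k (A B : 'M[R]_k) : R := \tr (A *m B).

Definition Lcone k : set 'cV[R]_(k + 1) :=
  [set x | norm2 (usubmx x) <= dsubmx x 0 0].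

Definition Qmx n : 'M[R]_(n + 1 + 1) :=
  block_mx (block_mx (- 2)%:M 0
                     0        0) (col_mx 0 1%:M)
           (row_mx 0 1%:M)       0.

Definition Pmx n : 'M[R]_(n + 1 + 1) :=
  block_mx (block_mx 2%:M 0
                     0    1%:M) (col_mx 0 (- 1)%:M)
           (row_mx 0 1%:M)      1%:M.

Definition pi_X n (Z : 'M[R]_(n + 1 + 1)) : 'M[R]_n := ulsubmx (ulsubmx Z).
Definition pi_x n (Z : 'M[R]_(n + 1 + 1)) : 'cV[R]_n := usubmx (ursubmx Z).

Section Balls.
Variables (n m : nat) (c : 'I_m -> 'cV[R]_n) (r : 'I_m -> R).

Definition ball_inter : set 'cV[R]_n :=
  [set x | forall i, norm2 (x - c i) <= r i].

Definition dvec (i : 'I_m) : 'cV[R]_(n + 1 + 1) :=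
  col_mx (col_mx (2 *: c i) (- 1)%:M) (r i ^+ 2 - norm2 (c i) ^+ 2)%:M.

Definition Cset (i j : 'I_m) : set 'M[R]_(n + 1 + 1) :=
  [set Z | [/\ psd Z,
               inner_mx (Qmx n) Z = 0,
               Lcone (Pmx n *m Z *m dvec i),
               Lcone (Pmx n *m Z *m dvec j) &
               0 <= ((dvec i)^T *m Z *m dvec j) 0 0]].

Definition Zmx (i j : 'I_m) (X : 'M[R]_n) (x : 'cV[R]_n) : 'M[R]_(n + n) :=
  block_mx
    (r i ^+ 2)%:M
    (X - x *m (c j)^T - c i *m x^T + c i *m (c j)^T)
    (X - c j *m x^T - x *m (c i)^T + c j *m (c i)^T)
    (r j ^+ 2)%:M.

End Balls.
End Defs.

(* Main.v *)
Require Import Defs.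
From mathcomp Require Import all_boot all_order all_algebra.
From mathcomp Require Import classical_sets reals.
From mathcomp Require Import ring lra.

Set Implicit Arguments.
Unset Strict Implicit.
Unset Printing Implicit Defensive.

Import Order.TTheory GRing.Theory Num.Theory.
Local Open Scope ring_scope.
Local Open Scope classical_set_scope.

(** With [X' = X - x x^T], the off-diagonal block of [Zmx] is
    [X' + (x - c_i) (x - c_j)^T]. Since [Z] is positive semidefinite, so is its
    Schur complement and hence [X'], which gives [a^T X' a <= tr X' |a|^2]. The
    second-order cone condition at [d^i], through its last two coordinates
    alone, gives [tr X' + |x - c_i|^2 <= r_i^2]; likewise for [j]. By
    Cauchy-Schwarz these two bounds control the cross terms of the form. *)

Lemma symmetricmxP (R : realType) k (A : 'M[R]_k) :
  reflect (A^T = A) (A \is symmetricmx).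
Proof.
(* [symmetricmx] is an instance of the Hermitian predicate: a sign with exponent 0 and an identity
   map have to be cleared. *)
rewrite qualifE /= expr0 scale1r map_mx_id //.
by apply: (iffP eqP) => [<-|->]; rewrite ?trmxK.
Qed.

Lemma norm2_sqr (R : realType) k (x : 'cV[R]_k) :
  norm2 x ^+ 2 = (x^T *m x) 0 0.
Proof.
rewrite /norm2 sqr_sqrtr ?sumr_ge0 // => [|i _]; last exact: sqr_ge0.
by rewrite mxE; apply: eq_bigr => i _; rewrite mxE expr2.
Qed.

Lemma ler_norm2 (R : realType) k (x : 'cV[R]_k) i : x i 0 <= norm2 x.
Proof.
apply: le_trans (ler_norm _) _; rewrite -sqrtr_sqr ler_wsqrtr //.
by rewrite (bigD1 i) //= lerDl sumr_ge0 // => l _; exact: sqr_ge0.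
Qed.

Lemma dotC (R : realType) k (a b : 'cV[R]_k) :
  (a^T *m b) 0 0 = (b^T *m a) 0 0.
Proof. by rewrite -[a^T *m b]trmxK trmx_mul trmxK mxE. Qed.

Lemma mul_mx11 (R : realType) (A B : 'M[R]_1) : (A *m B) 0 0 = A 0 0 * B 0 0.
Proof. by rewrite mxE big_ord1. Qed.

(** Without eigenvalues: the form is nonnegative at every v_q e_p - v_p e_q, and summing these
    values over all p, q gives twice the difference of the two sides. *)
Lemma psd_form_le_trace (R : realType) k (A : 'M[R]_k) (v : 'cV[R]_k) :
  psd A -> (v^T *m A *m v) 0 0 <= \tr A * (v^T *m v) 0 0.
Proof.
case=> /symmetricmxP symA posA.
have formE (u : 'cV[R]_k) :
    (u^T *m A *m u) 0 0 = \sum_p \sum_q u p 0 * A p q * u q 0.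
  rewrite mxE exchange_big; apply: eq_bigr => q _; rewrite mxE mulr_suml.
  by apply: eq_bigr => p _; rewrite mxE.
(* The form is nonnegative at v_q e_p - v_p e_q. *)
have minor p q : 0 <= v q 0 ^+ 2 * A p p + v p 0 ^+ 2 * A q q
                      - (v p 0 * A p q * v q 0) *+ 2.
  have := posA (v q 0 *: delta_mx p 0 - v p 0 *: delta_mx q 0).
  have deltaE s t :
      ((delta_mx s 0 : 'cV_k)^T *m A *m (delta_mx t 0 : 'cV_k)) 0 0 = A s t.
    by rewrite trmx_delta -rowE -colE !mxE.
  rewrite [(_ - _)^T]linearB /= ![(_ *: _)^T]linearZ /= !(mulmxBl, mulmxBr).
  rewrite -!scalemxAl -!scalemxAr.
  move: (deltaE p p) (deltaE p q) (deltaE q p) (deltaE q q).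
  have -> : A q p = A p q by rewrite -{1}symA mxE.
  do !rewrite ?mxE; move=> -> -> -> ->.
  by congr (0 <= _); ring.
have: 0 <= \sum_p \sum_q (v q 0 ^+ 2 * A p p + v p 0 ^+ 2 * A q q
                          - (v p 0 * A p q * v q 0) *+ 2).
  by apply: sumr_ge0 => p _; apply: sumr_ge0 => q _.
have -> : \sum_p \sum_q (v q 0 ^+ 2 * A p p + v p 0 ^+ 2 * A q q
                         - (v p 0 * A p q * v q 0) *+ 2)
   = (\tr A * (v^T *m v) 0 0 - (v^T *m A *m v) 0 0) *+ 2.
  have dotE : (v^T *m v) 0 0 = \sum_p v p 0 ^+ 2.
    by rewrite mxE; apply: eq_bigr => p _; rewrite mxE expr2.
  rewrite formE dotE.
  have diagE : \sum_p \sum_q v q 0 ^+ 2 * A p p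
             = \tr A * \sum_p v p 0 ^+ 2.
    rewrite /mxtrace mulr_suml; apply: eq_bigr => p _.
    by rewrite -mulr_suml mulrC.
  (* Of the two copies of tr A |v|^2, one is summed in exchanged order, so that both sides agree
     term by term. *)
  rewrite mulrnBl -sumrMnl mulr2n -{1}diagE -diagE [X in X + _ - _]exchange_big.
  rewrite -big_split -sumrB; apply: eq_bigr => p _ /=.
  rewrite -sumrMnl -big_split -sumrB; apply: eq_bigr => q _ /=.
  by rewrite addrC.
by rewrite pmulrn_lge0 // subr_ge0.
Qed.

Lemma psd_ulsubmx (R : realType) k l (A : 'M[R]_(k + l)) :
  psd A -> psd (ulsubmx A).
Proof.
case=> /symmetricmxP symA posA; split.
  by apply/symmetricmxP; rewrite trmx_ulsub symA.
move=> v; have := posA (col_mx v 0).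
rewrite -{1}[A]submxK tr_col_mx trmx0 mul_row_block !mul0mx !addr0.
by rewrite mul_row_col mulmx0 addr0.
Qed.

Lemma psd_schur (R : realType) k (A : 'M[R]_(k + 1)) :
  psd A -> drsubmx A 0 0 = 1 -> psd (ulsubmx A - ursubmx A *m (ursubmx A)^T).
Proof.
case=> /symmetricmxP symA posA A1; set x := ursubmx A.
have xT : dlsubmx A = x^T by rewrite trmx_ursub symA.
split.
  by apply/symmetricmxP; rewrite linearB /= trmx_mul trmxK trmx_ulsub symA.
(* As the corner is 1, this last coordinate minimizes the form for fixed v; the minimum is the form
   of the Schur complement. *)
move=> v; have := posA (col_mx v (- (x^T *m v))).
rewrite -{1}[A]submxK xT -/x tr_col_mx mul_row_block mul_row_col.
rewrite [drsubmx A]mx11_scalar A1 [(- _)^T]linearN /= trmx_mul trmxK mulmx1.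
rewrite !(mulmxDl, mulmxBr, mulNmx, mulmxN) !mulmxA.
by rewrite opprK addNr addr0.
Qed.

(** If z ends in u, w, then P z ends in u - w, u + w, and membership in the cone forces u - w <= u +
    w. *)
Lemma Lcone_Pmx (R : realType) n (z : 'cV[R]_(n + 1 + 1)) :
  Lcone (Pmx R n *m z) -> 0 <= dsubmx z 0 0.
Proof.
rewrite -[z]vsubmxK -[usubmx z]vsubmxK; set w := dsubmx z.
move: (usubmx (usubmx z)) (dsubmx (usubmx z)) => v u.
rewrite /Lcone /= /Pmx !(mul_block_col, mul_row_col, mul_col_mx).
rewrite !(mul0mx, mul1mx, add0r, addr0) add_col_mx.
rewrite !(col_mxKu, col_mxKd) => le_uw.
have := le_trans (ler_norm2 _ (rshift n 0)) le_uw.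
rewrite col_mxEd mul_scalar_mx !mxE.
by lra.
Qed.

(** The last coordinate of Z d is 2 x^T c - b + s^2 - |c|^2, where b is the entry of Z in row n+1
    and column n+2. It is nonnegative, and b = tr X because <Q, Z> = 2 b - 2 tr X. *)
Lemma Cset_trace_le (R : realType) n (Z : 'M[R]_(n + 1 + 1)) (c : 'cV[R]_n)
    (s : R) :
  psd Z -> inner_mx (Qmx R n) Z = 0 -> drsubmx Z 0 0 = 1 ->
  Lcone (Pmx R n *m Z *m
         col_mx (col_mx (2 *: c) (- 1)%:M) (s ^+ 2 - norm2 c ^+ 2)%:M) ->
  \tr (pi_X Z - pi_x Z *m (pi_x Z)^T) + norm2 (pi_x Z - c) ^+ 2 <= s ^+ 2.
Proof.
case=> /symmetricmxP symZ _ QZ Z1 /[!(=^~ mulmxA)] /Lcone_Pmx.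
have [X [y [y' [a [x [b [x' [b' ZE]]]]]]]] : exists X y y' a x b x' b',
    Z = block_mx (block_mx X y y' a) (col_mx x b) (row_mx x' b') 1%:M.
  exists (ulsubmx (ulsubmx Z)), (ursubmx (ulsubmx Z)), (dlsubmx (ulsubmx Z)),
    (drsubmx (ulsubmx Z)), (usubmx (ursubmx Z)), (dsubmx (ursubmx Z)),
    (lsubmx (dlsubmx Z)), (rsubmx (dlsubmx Z)).
  by rewrite submxK vsubmxK hsubmxK -Z1 -mx11_scalar submxK.
rewrite /pi_X /pi_x.
move: QZ symZ; rewrite ZE !(block_mxKul, block_mxKur, col_mxKu).
rewrite tr_block_mx tr_row_mx tr_col_mx => QZ /eq_block_mx[_ + _ _].
case/eq_col_mx => xE bE.
have {}QZ : b 0 0 = \tr X.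
  move: QZ.
  rewrite /inner_mx /Qmx mulmx_block mxtrace_block mul_col_row.
  rewrite mulmx_block add_block_mx !mxtrace_block mul_row_col.
  rewrite !(mul0mx, mul1mx, add0r, addr0).
  rewrite mul_scalar_mx mxtraceZ !trace_mx11 -bE mxE.
  by lra.
rewrite mul_block_col col_mxKd mul_row_col.
have -> : x' = x^T by rewrite -xE trmxK.
rewrite [\tr (_ - _)]linearB /= mxtrace_mulC trace_mx11 !norm2_sqr.
rewrite [(x - c)^T]linearB /= !(mulmxBl, mulmxBr).
rewrite -scalemxAr mul1mx mul_mx_scalar.
have := dotC c x; rewrite -QZ -bE.
move: (x^T *m x) (x^T *m c) (c^T *m x) (c^T *m c) => xx xc cx cc.
by rewrite !mxE eqxx mulr1n; lra.
Qed.

(** At (a, b) the diagonal terms satisfy s |a|^2 >= a^T A a + (a^T xi)^2 and t |b|^2 >= b^T A b +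
    (b^T eta)^2. Adding the cross terms completes the squares to (a + b)^T A (a + b) + (a^T xi + b^T
    eta)^2. *)
Lemma psd_block_trace (R : realType) k (A : 'M[R]_k) (xi eta : 'cV[R]_k)
    (s t : R) :
  psd A -> \tr A + norm2 xi ^+ 2 <= s -> \tr A + norm2 eta ^+ 2 <= t ->
  psd (block_mx s%:M (A + xi *m eta^T) (A + eta *m xi^T) t%:M).
Proof.
move=> psdA; rewrite !norm2_sqr => les leh.
have [/symmetricmxP symA posA] := psdA.
split.
  apply/symmetricmxP.
  by rewrite tr_block_mx !tr_scalar_mx !linearD /= !trmx_mul !trmxK symA.
(* Cauchy-Schwarz is the trace bound for the rank-one matrix z z^T, whose trace is |z|^2. *)
have CS (u z : 'cV[R]_k) :
    (u^T *m z) 0 0 ^+ 2 <= (z^T *m z) 0 0 * (u^T *m u) 0 0.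
  have psdz : psd (z *m z^T).
    split; first by apply/symmetricmxP; rewrite trmx_mul trmxK.
    by move=> w; rewrite mulmxA -mulmxA mul_mx11 dotC -expr2 sqr_ge0.
  have := psd_form_le_trace u psdz.
  rewrite mulmxA -mulmxA mul_mx11 (dotC z u) -expr2.
  by rewrite mxtrace_mulC trace_mx11.
move=> v; rewrite -[v]vsubmxK; move: (usubmx v) (dsubmx v) => a b.
rewrite tr_col_mx mul_row_block mul_row_col.
rewrite !(mulmxDl, mulmxDr) !mulmxA !mul_mx_scalar -!scalemxAl.
have := posA (a + b); rewrite [(_ + _)^T]linearD /= !(mulmxDl, mulmxDr).
have := psd_form_le_trace a psdA; have := psd_form_le_trace b psdA.
have := CS a xi; have := CS b eta.
have dot_ge0 (z : 'cV[R]_k) : 0 <= (z^T *m z) 0 0.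
  by rewrite -norm2_sqr sqr_ge0.
have := ler_wpM2r (dot_ge0 a) les; have := ler_wpM2r (dot_ge0 b) leh.
have -> : b^T *m eta *m xi^T *m a = (b^T *m eta) *m (xi^T *m a).
  by rewrite mulmxA.
have -> : a^T *m xi *m eta^T *m b = (a^T *m xi) *m (eta^T *m b).
  by rewrite mulmxA.
have := dotC eta b; have := dotC xi a.
move: (a^T *m xi) (b^T *m eta) (xi^T *m a) (eta^T *m b) => p q p' q'.
move: (a^T *m A *m a) (b^T *m A *m a) (a^T *m A *m b) (b^T *m A *m b).
move: (a^T *m a) (b^T *m b) (\tr A) => aa bb trA aAa bAa aAb bAb.
rewrite !mxE !big_ord1 => -> ->; have := sqr_ge0 (p 0 0 + q 0 0).
by lra.
Qed.

Theorem theorem6 (R : realType) (n m : nat) (hn : (1 <= n)%N) (hm : (2 <= m)%N)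
    (c : 'I_m -> 'cV[R]_n) (r : 'I_m -> R)
    (hS : ball_inter c r !=set0)
    (i j : 'I_m) (hij : i != j)
    (Z : 'M[R]_(n + 1 + 1)) (hZ : Cset c r i j Z)
    (hZ1 : drsubmx Z 0 0 = 1) :
  psd (Zmx c r i j (pi_X Z) (pi_x Z)).
Proof.
case: hZ => psdZ QZ Li Lj _.
set X := pi_X Z; set x := pi_x Z.
have offE (a b : 'cV[R]_n) : X - x *m b^T - a *m x^T + a *m b^T
    = (X - x *m x^T) + (x - a) *m (x - b)^T.
  rewrite [(x - b)^T]linearB /= mulmxBl !mulmxBr.
  move: (x *m x^T) (x *m b^T) (a *m x^T) (a *m b^T) => xx xb ax ab.
  by apply/matrixP => p q; rewrite !mxE; ring.
rewrite /Zmx offE.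
have -> : X - c j *m x^T - x *m (c i)^T + c j *m (c i)^T
    = (X - x *m x^T) + (x - c j) *m (x - c i)^T.
  by rewrite -offE; congr (_ + _); rewrite addrAC.
apply: psd_block_trace; last 2 first.
- exact: Cset_trace_le Li.
- exact: Cset_trace_le Lj.
(* The Schur complement eliminates coordinate n+2; its leading block then drops coordinate n+1. *)
suff -> : X - x *m x^T = ulsubmx (ulsubmx Z - ursubmx Z *m (ursubmx Z)^T).
  exact/psd_ulsubmx/psd_schur.
rewrite -[ulsubmx Z]submxK -[ursubmx Z]vsubmxK tr_col_mx mul_col_row.
by rewrite opp_block_mx add_block_mx block_mxKul.
Qed.
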